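(* For every nonempty weakly convex compact metric space $X$, the set $C^{\infty}(X)$ consists of a single point.
   Context: A metric space $(X,d)$ is weakly convex if for any two points $x,y\in X$ there is a point $z\in X$ such that for each $w\in X$: (C1) $d(z,w)\le\max(d(x,w),d(y,w))$; and (C2) if $d(z,w)=\max(d(x,w),d(y,w))$ then $d(x,w)=d(y,w)$. For a metric space $(X,d)$ and $x\in X$ put $r_X(x):=\sup_{y\in X}d(x,y)$, and put $r(X):=\inf_{x\in X}r_X(x)$ (with $r(\varnothing):=0$). The Chebyshev center of $X$ is the set $C(X):=\{x\in X: r_X(x)=r(X)\}$, regarded as a metric space with the restricted metric. The $n$-th Chebyshev centers are defined recursively by $C^0(X):=X$ and $C^n(X):=C(C^{n-1}(X))$ for $n>0$ (so radii are computed inside $C^{n-1}(X)$), and $C^{\infty}(X):=\bigcap_{n=0}^{\infty}C^n(X)$. *)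

(* Defs.v *)
From HB Require Import structures.
From mathcomp Require Import all_boot all_order all_algebra.
From mathcomp Require Import all_classical all_reals all_analysis.

Set Implicit Arguments.
Unset Strict Implicit.
Unset Printing Implicit Defensive.

Import Order.TTheory GRing.Theory Num.Theory.

Local Open Scope classical_set_scope.
Local Open Scope ring_scope.

Definition weakly_convex (R : realType) (X : metricType R) : Prop :=
  forall x y : X, exists z : X, forall w : X,
    mdist z w <= Num.max (mdist x w) (mdist y w) /\
    (mdist z w = Num.max (mdist x w) (mdist y w) -> mdist x w = mdist y w).

(* A subset A of X stands for the metric space A with the restricted metric.
   Radii are extended reals, so that they are also right for unbounded A. *)
Definition radius_at (R : realType) (X : metricType R) (A : set X) (x : X) :
    \bar R :=
  ereal_sup [set (mdist x y)%:E | y in A].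

(* The case split is needed because ereal_inf set0 = +oo. *)
Definition radius (R : realType) (X : metricType R) (A : set X) : \bar R :=
  if A == set0 then 0%E else ereal_inf [set radius_at A x | x in A].

Definition chebyshev_center (R : realType) (X : metricType R) (A : set X) :
    set X :=
  [set x | A x /\ radius_at A x = radius A].

Definition nth_center (R : realType) (X : metricType R) (n : nat) : set X :=
  iter n (@chebyshev_center R X) [set: X].
Arguments nth_center {R} X n _.

Definition center_infty (R : realType) (X : metricType R) : set X :=
  \bigcap_n nth_center X n.
Arguments center_infty {R} X _.

(* Main.v *)
Require Import Defs.
From HB Require Import structures.
From mathcomp Require Import all_boot all_order all_algebra.
From mathcomp Require Import all_classical all_reals all_analysis.

Import Order.TTheory GRing.Theory Num.Theory.

Local Open Scope classical_set_scope.
Local Open Scope ring_scope.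

(** Let [K] be the intersection of the iterated centers and [s] the infimum of
    their radii.  Any two points of [K] are at distance at most [s], and by
    compactness every [x] in [K] has a nonempty set [F x] of points of [K] at
    distance at least [s].  If [z] is the point given by weak convexity for
    [x, y] in [K], then [z] is in [K] and [F z] is contained in both [F x] and
    [F y].  Hence the sets [F x] form a directed family of compact sets, and a
    common point [w] satisfies [s <= d(w, w) = 0]. *)

(** Directedness makes the sets [f i] a base of a proper filter. Compactness gives it a cluster
    point, which lies in every [f i] because these are closed. All later existence claims come from
    this lemma, for chains as well as for the final directed family. *)
Lemma compact_directed_bigcap (T : topologicalType) (I : Type) (D : set I)
    (f : I -> set T) :
  compact [set: T] -> D !=set0 ->
  (forall i, D i -> closed (f i)) -> (forall i, D i -> f i !=set0) ->
  (forall i j, D i -> D j -> exists2 k, D k & f k `<=` f i `&` f j) ->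
  \bigcap_(i in D) f i !=set0.
Proof.
move=> cT [i0 Di0] fcl f0 fdir.
have FF : ProperFilter (filter_from D f).
  by apply: filter_from_proper => //; apply: filter_from_filter => //; exists i0.
have [|p [_ clp]] := cT _ FF; first by exists i0.
exists p => i Di; apply: fcl => // B pB.
by apply: clp => //; exists i.
Qed.

Section chebyshev_center.
Context {R : realType} {X : metricType R}.
Implicit Types (A : set X) (x y z w : X).

Lemma mdist_continuous x : continuous (mdist x : X -> R^o).
Proof.
move=> y; apply/cvgrPdist_lt => e e0.
have : \forall t \near y, ball y e t by exact: nbhsx_ballx.
apply: filterS => t; rewrite ballEmdist/= => yt.
rewrite (le_lt_trans _ yt)// ler_norml lerBrDr lerBlDr.
rewrite addrC lerBlDr metric_triangle/=.
by rewrite [X in _ <= X + _]metric_sym addrC metric_triangle.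
Qed.

Lemma mdistE_continuous x : continuous (fun y => (mdist x y)%:E).
Proof.
move=> y; apply: cvg_EFin; first exact: nearW.
exact: mdist_continuous.
Qed.

Lemma closed_mdist_le x (s : \bar R) : closed [set y | ((mdist x y)%:E <= s)%E].
Proof.
apply: (@preimage_closed _ _ (fun y => (mdist x y)%:E) [set r | (r <= s)%E]).
  by move=> y _; exact: mdistE_continuous.
exact: closed_ereal_ge_ereal.
Qed.

Lemma closed_mdist_ge x (s : \bar R) : closed [set y | (s <= (mdist x y)%:E)%E].
Proof.
apply: (@preimage_closed _ _ (fun y => (mdist x y)%:E) [set r | (s <= r)%E]).
  by move=> y _; exact: mdistE_continuous.
exact: closed_ereal_le_ereal.
Qed.

Lemma radius_at_leP A x (s : \bar R) :
  (radius_at A x <= s)%E <-> forall y, A y -> ((mdist x y)%:E <= s)%E.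
Proof.
split=> [As y Ay|As]; last by apply: ge_ereal_sup => _ [y /As ? <-].
by rewrite (le_trans _ As)//; apply: ereal_sup_ubound; exists y.
Qed.

(** By symmetry of the distance, the sublevel set is an intersection of closed balls of radius [s]
    centred at the points of [A]. *)
Lemma closed_radius_at_le A (s : \bar R) :
  closed [set x | (radius_at A x <= s)%E].
Proof.
rewrite [X in closed X](_ : _ =
    \bigcap_(y in A) [set x | ((mdist y x)%:E <= s)%E]).
  by apply: closed_bigI => y _; exact: closed_mdist_le.
apply/seteqP; split=> [x /radius_at_leP Ax y Ay|x Ax] /=.
  by rewrite metric_sym; exact: Ax.
by apply/radius_at_leP => y /Ax; rewrite /= metric_sym.
Qed.

Lemma radius_le A x : A x -> (Defs.radius A <= radius_at A x)%E.
Proof.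
move=> Ax; rewrite /Defs.radius; case: ifPn => [/eqP A0|_].
  by move: Ax; rewrite A0.
by apply: ereal_inf_lbound; exists x.
Qed.

(** The radius is a lower bound over [A], so equality weakens to an inequality and the center
    becomes a sublevel set, to which closedness applies. *)
Lemma chebyshev_centerE A :
  chebyshev_center A = A `&` [set x | (radius_at A x <= Defs.radius A)%E].
Proof.
apply/seteqP; split=> x [Ax /=]; first by move=> ->.
by move=> rx; split=> //; apply/eqP; rewrite eq_le rx radius_le.
Qed.

Lemma closed_chebyshev_center A : closed A -> closed (chebyshev_center A).
Proof.
move=> Acl; rewrite chebyshev_centerE.
by apply: closedI => //; exact: closed_radius_at_le.
Qed.

(** The sublevel sets of [radius_at A] in [A], at the levels it takes on [A], form a chain of
    nonempty closed sets; a common point minimizes [radius_at A]. *)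
Lemma chebyshev_center_neq0 A :
  compact [set: X] -> closed A -> A !=set0 -> chebyshev_center A !=set0.
Proof.
move=> cX Acl A0; rewrite chebyshev_centerE.
have [x Ax|x Ax|x y Ax Ay|z Az] := @compact_directed_bigcap X X A
    (fun x => A `&` [set y | (radius_at A y <= radius_at A x)%E]) cX A0.
- by apply: closedI => //; exact: closed_radius_at_le.
- by exists x; split => /=.
- have [xy|/ltW yx] := leP (radius_at A x) (radius_at A y).
    by exists x => // w [Aw wx]; do !split=> //; exact: le_trans xy.
  by exists y => // w [Aw wy]; do !split=> //; exact: le_trans yx.
have [x Ax] := A0; exists z; split=> /=; first by have [] := Az _ Ax.
rewrite /Defs.radius; case: ifPn => [/eqP A_eq0|_].
  by move: Ax; rewrite A_eq0.
by apply: le_ereal_inf_tmp => _ [y Ay <-]; have [] := Az _ Ay.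
Qed.

(** The dual chain argument, with superlevel sets of the distance to [x]: a common point is a point
    of [A] farthest from [x]. *)
Lemma radius_at_attained A x :
  compact [set: X] -> closed A -> A !=set0 ->
  exists2 w, A w & (radius_at A x <= (mdist x w)%:E)%E.
Proof.
move=> cX Acl A0.
have [y Ay|y Ay|y z Ay Az|w Aw] := @compact_directed_bigcap X X A
    (fun y => A `&` [set w | ((mdist x y)%:E <= (mdist x w)%:E)%E]) cX A0.
- by apply: closedI => //; exact: closed_mdist_ge.
- by exists y; split => /=.
- have [yz|/ltW zy] := leP (mdist x y)%:E (mdist x z)%:E.
    by exists z => // w [Aw wz]; do !split=> //; exact: le_trans wz.
  by exists y => // w [Aw wy]; do !split=> //; exact: le_trans wy.
have [y Ay] := A0; exists w; first by have [] := Aw _ Ay.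
by apply/radius_at_leP => v Av; have [] := Aw _ Av.
Qed.

Lemma nth_centerS n : nth_center X n.+1 = chebyshev_center (nth_center X n).
Proof. by []. Qed.

Lemma nth_center_closed n : closed (nth_center X n).
Proof.
elim: n => [|n IHn]; first exact: closedT.
by rewrite nth_centerS; exact: closed_chebyshev_center.
Qed.

Lemma nth_center_neq0 n :
  compact [set: X] -> [set: X] !=set0 -> nth_center X n !=set0.
Proof.
move=> cX X0; elim: n => [//|n IHn]; rewrite nth_centerS.
by apply: chebyshev_center_neq0 => //; exact: nth_center_closed.
Qed.

Lemma nth_center_decr m n :
  (m <= n)%N -> nth_center X n `<=` nth_center X m.
Proof.
elim: n => [|n IHn]; first by rewrite leqn0 => /eqP ->.
rewrite leq_eqVlt => /orP[/eqP -> //|/IHn nm] x.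
by rewrite nth_centerS => -[/nm].
Qed.

(** Condition (C1) carries any common bound on the distances from [x] and [y] over to [z], so the
    radius bound passes to [z] at each stage. *)
Lemma nth_center_weakly_convex n x y z :
  (forall w, mdist z w <= Num.max (mdist x w) (mdist y w)) ->
  nth_center X n x -> nth_center X n y -> nth_center X n z.
Proof.
move=> zxy; elim: n => [//|n IHn]; rewrite nth_centerS chebyshev_centerE.
move=> [nx /radius_at_leP rx] [ny /radius_at_leP ry]; split; first exact: IHn.
apply/radius_at_leP => w nw; rewrite (@le_trans _ _
  (Num.max (mdist x w) (mdist y w))%:E) ?lee_fin//.
by rewrite EFin_max ge_max rx ?ry.
Qed.

Lemma center_infty_neq0 :
  compact [set: X] -> [set: X] !=set0 -> center_infty X !=set0.
Proof.
move=> cX X0; apply: compact_directed_bigcap.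
- exact: cX.
- by exists 0%N.
- by move=> n _; exact: nth_center_closed.
- by move=> n _; exact: nth_center_neq0.
move=> m n _ _; exists (maxn m n) => // x xmn.
by split; apply: nth_center_decr xmn; rewrite (leq_maxl, leq_maxr).
Qed.

Definition radius_infty : \bar R :=
  ereal_inf (range (fun n => Defs.radius (nth_center X n))).

Lemma center_infty_mdist_le x y : center_infty X x -> center_infty X y ->
  ((mdist x y)%:E <= radius_infty)%E.
Proof.
move=> Kx Ky; apply: le_ereal_inf_tmp => _ [n _ <-].
(* Membership of [x] one stage later bounds its distance to every point of stage [n], hence to [y],
   by the radius of stage [n]. *)
have := Kx n.+1 Logic.I; rewrite nth_centerS chebyshev_centerE.
by move=> [_ /radius_at_leP]; apply; exact: Ky.
Qed.

(** A point of stage [n] farthest from [x] is at distance at least the radius of that stage, hence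
    at least [radius_infty]. The sets [G n] of such distant points are closed and nested, so they
    share a point. *)
Lemma center_infty_mdist_ge x : compact [set: X] -> center_infty X x ->
  exists2 w, center_infty X w & (radius_infty <= (mdist x w)%:E)%E.
Proof.
move=> cX Kx; pose G n := nth_center X n `&`
  [set w | (radius_infty <= (mdist x w)%:E)%E].
have [||n _|n _|m n _ _|w Gw] := @compact_directed_bigcap X nat setT G.
- exact: cX.
- by exists 0%N.
- by apply: closedI; [exact: nth_center_closed|exact: closed_mdist_ge].
- have [|w nw xw] := @radius_at_attained (nth_center X n) x cX
    (@nth_center_closed n).
    by exists x; exact: Kx.
  exists w; split=> //=; apply: le_trans xw.
  apply: le_trans (@radius_le _ _ (Kx n Logic.I)).
  by apply: ereal_inf_lbound; exists n.
- exists (maxn m n) => // w [wmn xw].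
  by do !split=> //; apply: nth_center_decr wmn; rewrite (leq_maxl, leq_maxr).
exists w; last by have [] := Gw 0%N Logic.I.
by move=> n _; have [] := Gw n Logic.I.
Qed.

Lemma radius_infty_le0 : compact [set: X] -> [set: X] !=set0 ->
  weakly_convex X -> (radius_infty <= 0)%E.
Proof.
move=> cX X0 wcX; pose F x := center_infty X `&`
  [set w | (radius_infty <= (mdist x w)%:E)%E].
have [||x Kx|x Kx|x y Kx Ky|w Fw] :=
    @compact_directed_bigcap X X (center_infty X) F.
- exact: cX.
- exact: center_infty_neq0.
- apply: closedI; last exact: closed_mdist_ge.
  by apply: closed_bigI => n _; exact: nth_center_closed.
- by have [w Kw xw] := center_infty_mdist_ge _ cX Kx; exists w.
- have [z zP] := wcX x y; exists z.
    move=> n nT; apply: (@nth_center_weakly_convex n x y).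
    + by move=> w; have [] := zP w.
    + exact: Kx.
    + exact: Ky.
  move=> w [Kw /= zw]; have [zle zeq] := zP w.
  have xle := center_infty_mdist_le _ _ Kx Kw.
  have yle := center_infty_mdist_le _ _ Ky Kw.
  (* Both distances are at most [radius_infty], which is at most [mdist z w]; this forces equality
     in (C1), and (C2) then makes all three distances equal. *)
  have zE : mdist z w = Num.max (mdist x w) (mdist y w).
    apply/eqP; rewrite eq_le zle/= -lee_fin (le_trans _ zw)//.
    by rewrite EFin_max ge_max xle.
  have xyE := zeq zE; move: zw; rewrite zE xyE maxxx => zw.
  by rewrite /F; do !split=> //=; rewrite xyE.
have [x Kx] := center_infty_neq0 cX X0.
(* The common point [w] is itself in [center_infty X], so it is a valid index and belongs to
   [F w]. *)
by have [Kw _] := Fw _ Kx; have [_ /=] := Fw _ Kw; rewrite mdistxx.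
Qed.

End chebyshev_center.

Theorem proposition3p4 (R : realType) (X : metricType R) :
  [set: X] !=set0 -> compact [set: X] -> weakly_convex X ->
  exists x : X, center_infty X = [set x].
Proof.
move=> X0 cX wcX; have [x Kx] := center_infty_neq0 cX X0.
exists x; apply/seteqP; split=> [y Ky|_ ->//] /=.
have := le_trans (center_infty_mdist_le _ _ Ky Kx) (radius_infty_le0 cX X0 wcX).
rewrite lee_fin => yx; apply: mdist_positivity.
by apply/eqP; rewrite eq_le yx mdist_ge0.
Qed.
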